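(* Let $k$ be a field of characteristic $p>0$, and let $R=(G,\chi,a,\alpha)$ and $R'=(G',\chi',a',\alpha')$ be two tuples defining Hopf algebras $H_R$ and $H_{R'}$ over $k$ (with $\alpha=(\alpha_{-1},\dots,\alpha_{r-1})$, $\alpha'=(\alpha'_{-1},\dots,\alpha'_{r'-1})$). Let $N$ be the order of $\chi(a)$ and $n=p^rN$. Then $H_R$ and $H_{R'}$ are isomorphic as Hopf algebras if and only if $r=r'$ and there are a group isomorphism $f:G\to G'$ with $f(a)=a'$ and $\chi=\chi'\circ f$, and an element $\beta\in k^*$, such that $\beta^{Np^i}\alpha_i=\beta^n\alpha_i'$ for all $0\le i\le r-1$ and $\alpha_{-1}=\beta^n\alpha'_{-1}$.
   Context: First type $H_R$. Let $R=(G,\chi,a,\alpha)$ where $G$ is a finite group, $a\in Z(G)$, $\chi:G\to k^*$ a linear character with $\chi(a)\ne 1$, $\alpha=(\alpha_{-1},\alpha_0,\dots,\alpha_{r-1})\in k^{r+1}$, $r\ge 0$. Let $N$ be the order of $\chi(a)$ and $n=p^rN$. It is assumed that $\alpha_{-1}=0$ if $a^n=1$; that if $\alpha_i\ne0$ for some $i\ge0$ then $a^{N(p^r-p^i)}=1$ and $\chi(g)^{N(p^r-p^i)}=1$ for all $g\in G$; and that if $\alpha_{-1}\neq0$ then $\chi(g)^{Np^r}=1$ for all $g\in G$. $H_R$ is the algebra containing $kG$ and an element $x$, with basis $(gx^i)_{g\in G,\,0\le i\le n-1}$ and relations $gxg^{-1}=\chi(g)x$ ($g\in G$), $x^n=\alpha_{-1}(a^n-1)+\sum_{i=0}^{r-1}\alpha_ix^{p^iN}$;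 its Hopf structure is $\Delta(gx^i)=(g\otimes g)(x\otimes a+1\otimes x)^i$, $\epsilon(gx^i)=\delta_{i,0}$, $S(gx^i)=(-xa^{-1})^ig^{-1}$. *)

(* Defs.v *)
From HB Require Import structures.
From mathcomp Require Import all_boot all_order all_algebra.
From mathcomp Require Import all_fingroup all_solvable all_field.

Set Implicit Arguments.
Unset Strict Implicit.
Unset Printing Implicit Defensive.

Import GRing.Theory.
Local Open Scope ring_scope.

(* Tensor product of finite-dimensional spaces: a tensor is stored as the
   matrix of its coordinates in the basis of the e_i *t e_j, where (e_i) and
   (e_j) are the chosen bases [vbasis fullv] of the two factors. [pure] is the
   universal bilinear map and [tens_ext f] is the linear map induced by the
   bilinear map [f]; see [tens_extE] and [tens_ind]. *)
Section Tensor.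
Variable k : fieldType.

Definition tens (U V : vectType k) : Type := 'M[k]_(\dim {:U}, \dim {:V}).

HB.instance Definition _ (U V : vectType k) :=
  Vector.copy (tens U V) 'M[k]_(\dim {:U}, \dim {:V}).

Variables U V : vectType k.

Definition pure (u : U) (v : V) : tens U V :=
  \matrix_(i, j) (coord (vbasis {:U}) i u * coord (vbasis {:V}) j v).

Definition tens_ext (W : lmodType k) (f : U -> V -> W) (t : tens U V) : W :=
  \sum_i \sum_j (t : 'M_(_, _)) i j *: f (vbasis {:U})`_i (vbasis {:V})`_j.

Definition bilinear_map (W : lmodType k) (f : U -> V -> W) : Prop :=
  (forall v, linear (f^~ v)) /\ (forall u, linear (f u)).

Lemma pure_bilinear : bilinear_map pure.
Proof.
by split=> w c x y; apply/matrixP=> i j; rewrite !mxE linearP /=;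
  rewrite ?(mulrDl, mulrDr) ?mulrA // (mulrC _ c).
Qed.

Lemma tens_ext_is_linear (W : lmodType k) (f : U -> V -> W) :
  linear (tens_ext f).
Proof.
move=> c s t; rewrite /tens_ext scaler_sumr -big_split; apply: eq_bigr => i _.
rewrite scaler_sumr -big_split; apply: eq_bigr => j _ /=.
by rewrite !mxE scalerDl scalerA.
Qed.

HB.instance Definition _ (W : lmodType k) (f : U -> V -> W) :=
  GRing.isLinear.Build k (tens U V) W _ (tens_ext f) (tens_ext_is_linear f).

Lemma tens_extE (W : lmodType k) (f : U -> V -> W) :
  bilinear_map f -> forall u v, tens_ext f (pure u v) = f u v.
Proof.
case=> fl fr u v.
pose gl y := GRing.isLinear.Build k U W _ (f^~ y) (fl y).
pose gr x := GRing.isLinear.Build k V W _ (f x) (fr x).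
pose Fl y : {linear U -> W} := HB.pack (f^~ y) (gl y).
pose Fr x : {linear V -> W} := HB.pack (f x) (gr x).
have Eu : f u v = \sum_i coord (vbasis {:U}) i u *: f (vbasis {:U})`_i v.
  rewrite {1}(coord_vbasis (memvf u)) -[LHS]/(Fl v _) linear_sum.
  by apply: eq_bigr => i _; rewrite linearZ.
rewrite Eu; apply: eq_bigr => i _.
rewrite {2}(coord_vbasis (memvf v)) -[f _ _]/(Fr _ _) linear_sum scaler_sumr.
by apply: eq_bigr => j _; rewrite linearZ /= mxE scalerA.
Qed.

Lemma tens_pureE (t : tens U V) : t = tens_ext pure t.
Proof.
have nz (X : vectType k) (i j : 'I_(\dim {:X})) :
    coord (vbasis {:X}) j (vbasis {:X})`_i = (j == i)%:R.
  by rewrite coord_free ?(basis_free (vbasisP _)) // eq_sym.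
rewrite [LHS]matrix_sum_delta; apply: eq_bigr => i _; apply: eq_bigr => j _.
congr (_ *: _); apply/matrixP=> i' j'; by rewrite !mxE !nz -natrM mulnb.
Qed.

Lemma tens_ind (W : lmodType k) (f g : {linear tens U V -> W}) :
  (forall u v, f (pure u v) = g (pure u v)) -> f =1 g.
Proof.
move=> fg t; rewrite (tens_pureE t) !linear_sum; apply: eq_bigr => i _.
by rewrite !linear_sum; apply: eq_bigr => j _; rewrite !linearZ /= fg.
Qed.

End Tensor.

Notation "u *t v" := (pure u v) (at level 40, left associativity) : ring_scope.

Definition tens_map (k : fieldType) (U V U' V' : vectType k)
    (f : U -> U') (g : V -> V') : tens U V -> tens U' V' :=
  tens_ext (fun u v => f u *t g v).

Definition tens_assoc (k : fieldType) (U V W : vectType k) :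
    tens (tens U V) W -> tens U (tens V W) :=
  tens_ext (fun uv w => tens_ext (fun u v => u *t (v *t w)) uv).

Section TensorAlgebra.
Variables (k : fieldType) (A B : falgType k).

Definition tens_mul (s t : tens A B) : tens A B :=
  tens_ext (fun a b => tens_ext (fun a' b' => (a * a') *t (b * b')) t) s.

Let pureDl a a' (b : B) : (a + a' : A) *t b = a *t b + a' *t b.
Proof. by have [h _] := pure_bilinear A B; have := h b 1 a a'; rewrite !scale1r. Qed.
Let pureDr (a : A) (b b' : B) : a *t (b + b') = a *t b + a *t b'.
Proof. by have [_ h] := pure_bilinear A B; have := h a 1 b b'; rewrite !scale1r. Qed.
Let pureZl c (a : A) (b : B) : (c *: a) *t b = c *: (a *t b).
Proof. by apply/matrixP=> i j; rewrite !mxE linearZ /= mulrA. Qed.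
Let pureZr c (a : A) (b : B) : a *t (c *: b) = c *: (a *t b).
Proof. by apply/matrixP=> i j; rewrite !mxE linearZ /= mulrCA. Qed.

Let ext_scale (f g : A -> B -> tens A B) c t :
  tens_ext (fun a b => c *: f a b + g a b) t =
  c *: tens_ext f t + tens_ext g t.
Proof.
rewrite /tens_ext scaler_sumr -big_split; apply: eq_bigr => i _.
rewrite scaler_sumr -big_split; apply: eq_bigr => j _ /=.
by rewrite scalerDr !scalerA (mulrC c).
Qed.

Let eq_ext (f g : A -> B -> tens A B) t :
  (forall a b, f a b = g a b) -> tens_ext f t = tens_ext g t.
Proof.
by move=> fg; apply: eq_bigr => i _; apply: eq_bigr => j _; rewrite fg.
Qed.

Lemma tens_mul_linl t : linear (tens_mul^~ t).
Proof. by move=> c s s'; rewrite /tens_mul linearP. Qed.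

Lemma tens_mul_linr s : linear (tens_mul s).
Proof. by move=> c t t'; rewrite -ext_scale; apply: eq_ext => a b; rewrite linearP. Qed.

Lemma tens_mul_pure a b a' b' :
  tens_mul (a *t b) (a' *t b') = (a * a') *t (b * b').
Proof.
rewrite /tens_mul tens_extE.
  rewrite tens_extE //; split=> [y|x] c u v;
  by rewrite mulrDr -scalerAr ?(pureDl, pureDr, pureZl, pureZr).
split=> [y|x] c u v; rewrite -ext_scale; apply: eq_ext => x' y';
by rewrite mulrDl -scalerAl ?(pureDl, pureDr, pureZl, pureZr).
Qed.

Let mulL t := GRing.isLinear.Build k _ _ _ (tens_mul^~ t) (tens_mul_linl t).
Let mulR s := GRing.isLinear.Build k _ _ _ (tens_mul s) (tens_mul_linr s).
Let ML t : {linear tens A B -> tens A B} := HB.pack (tens_mul^~ t) (mulL t).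
Let MR s : {linear tens A B -> tens A B} := HB.pack (tens_mul s) (mulR s).

Lemma tens_mulA : associative tens_mul.
Proof.
move=> r s t.
apply: (tens_ind (f := ML (tens_mul s t)) (g := ML t \o ML s)) => a b /=.
apply: (tens_ind (f := MR (a *t b) \o ML t) (g := ML t \o MR (a *t b))).
move=> a' b' /=.
apply: (tens_ind (f := MR (a *t b) \o MR (a' *t b'))
                 (g := MR (tens_mul (a *t b) (a' *t b')))) => a'' b'' /=.
by rewrite !tens_mul_pure !mulrA.
Qed.

Lemma tens_mul1 : left_id (1 *t 1) tens_mul.
Proof.
move=> t; apply: (tens_ind (f := MR (1 *t 1)) (g := idfun)) => a b /=.
by rewrite tens_mul_pure !mul1r.
Qed.

Lemma tens_mulr1 : right_id (1 *t 1) tens_mul.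
Proof.
move=> t; apply: (tens_ind (f := ML (1 *t 1)) (g := idfun)) => a b /=.
by rewrite tens_mul_pure !mulr1.
Qed.

Lemma tens_mulDl : left_distributive tens_mul +%R.
Proof. by move=> r s t; rewrite -[LHS]/(ML t _) linearD. Qed.

Lemma tens_mulDr : right_distributive tens_mul +%R.
Proof. by move=> r s t; rewrite -[LHS]/(MR r _) linearD. Qed.

Lemma tens_1_neq0 : (1 *t 1 : tens A B) != 0.
Proof.
have nz (C : falgType k) : exists i, coord (vbasis {:C}) i 1 != 0.
  apply/existsP; apply: contraTT (oner_neq0 C) => /existsPn z; rewrite negbK.
  rewrite (coord_vbasis (memvf 1)) big1 // => i _.
  by move: (z i); rewrite negbK => /eqP ->; rewrite scale0r.
have [[i nzi] [j nzj]] := (nz A, nz B).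
apply/eqP=> /matrixP/(_ i j); rewrite !mxE => /eqP.
by rewrite mulf_eq0 (negPf nzi) (negPf nzj).
Qed.

HB.instance Definition _ := GRing.Zmodule_isNzRing.Build (tens A B)
  tens_mulA tens_mul1 tens_mulr1 tens_mulDl tens_mulDr tens_1_neq0.

Lemma pureM (a : A) (b : B) a' b' :
  (a *t b) * (a' *t b') = (a * a') *t (b * b').
Proof. by rewrite -[RHS]tens_mul_pure. Qed.

Lemma pure11 : 1 *t 1 = 1 :> tens A B.
Proof. by []. Qed.

Lemma tens_scalerAl c (s t : tens A B) : c *: (s * t) = (c *: s) * t.
Proof. by rewrite -[RHS]/(ML t _) linearZ. Qed.

HB.instance Definition _ :=
  GRing.Lmodule_isLalgebra.Build k (tens A B) tens_scalerAl.

Lemma tens_scalerAr c (s t : tens A B) : c *: (s * t) = s * (c *: t).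
Proof. by rewrite -[RHS]/(MR s _) linearZ. Qed.

HB.instance Definition _ :=
  GRing.Lalgebra_isAlgebra.Build k (tens A B) tens_scalerAr.

End TensorAlgebra.

Record hopfAlgebra (k : fieldType) := HopfAlgebra {
  hopf_sort :> falgType k;
  comul : {lrmorphism hopf_sort -> tens hopf_sort hopf_sort};
  counit : {lrmorphism hopf_sort -> k^o};
  antipode : {linear hopf_sort -> hopf_sort};
  comulA : forall h,
    tens_assoc (tens_map comul idfun (comul h)) = tens_map idfun comul (comul h);
  counitl : forall h, tens_ext (fun u v => counit u *: v) (comul h) = h;
  counitr : forall h, tens_ext (fun u v => counit v *: u) (comul h) = h;
  antipodel : forall h,
    tens_ext (fun u v => antipode u * v) (comul h) = (counit h)%:A;
  antipoder : forall h,
    tens_ext (fun u v => u * antipode v) (comul h) = (counit h)%:A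
}.
Arguments comul {k h} : rename.
Arguments counit {k h} : rename.
Arguments antipode {k h} : rename.

Definition hopf_isomorphic (k : fieldType) (H H' : hopfAlgebra k) : Prop :=
  exists F : {lrmorphism H -> H'},
  [/\ bijective F,
      forall h, comul (F h) = tens_map F F (comul h),
      forall h, counit (F h) = counit h
    & forall h, antipode (F h) = F (antipode h)].

(* A tuple (G, chi, a, alpha) defining a Hopf algebra in characteristic p. The
   finite group G is the whole of [dG]; alpha = (alpha_{-1}, ..., alpha_{r-1})
   is split into [dalpham1] = alpha_{-1} and [dalpha i] = alpha_i, 0 <= i < r.
   [dN] carries no information: it is determined by [dN_order]. *)
Record hopf_datum (k : fieldType) (p : nat) := HopfDatum {
  dG : finGroupType;
  dchi : dG -> k;
  da : dG;
  dr : nat;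
  dalpham1 : k;
  dalpha : 'I_dr -> k;
  dN : nat;
  dn := (p ^ dr * dN)%N;
  dchi_neq0 : forall g, dchi g != 0;
  dchiM : forall g h, dchi (g * h)%g = dchi g * dchi h;
  da_central : da \in 'Z([set: dG])%g;
  dchi_a_neq1 : dchi da != 1;
  dN_order : dN.-primitive_root (dchi da);
  dalpham1_0 : (da ^+ dn = 1)%g -> dalpham1 = 0;
  dalpha_a : forall i, dalpha i != 0 ->
    (da ^+ (dN * (p ^ dr - p ^ i)) = 1)%g;
  dalpha_chi : forall i, dalpha i != 0 ->
    forall g, dchi g ^+ (dN * (p ^ dr - p ^ i)) = 1;
  dalpham1_chi : dalpham1 != 0 -> forall g, dchi g ^+ (dN * p ^ dr) = 1
}.

(* [H] is a model of H_R: [iota] is the inclusion of (the basis of) kG; its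
   injectivity is part of [HR_basis]. *)
Record HR_spec (k : fieldType) (p : nat) (R : hopf_datum k p)
    (H : hopfAlgebra k) (iota : dG R -> H) (x : H) : Prop := HRSpec {
  HR_1 : iota 1%g = 1;
  HR_M : forall g h, iota (g * h)%g = iota g * iota h;
  HR_basis :
    basis_of {:H} [seq iota gi.1 * x ^+ gi.2 | gi : dG R * 'I_(dn R)];
  HR_conj : forall g, iota g * x * iota g^-1%g = dchi g *: x;
  HR_pow : x ^+ dn R = dalpham1 R *: (iota (da R ^+ dn R)%g - 1)
             + \sum_(i < dr R) dalpha i *: x ^+ (p ^ i * dN R);
  HR_comul : forall g (i : 'I_(dn R)),
    comul (iota g * x ^+ i)
      = (iota g *t iota g) * (x *t iota (da R) + 1 *t x) ^+ i;
  HR_counit : forall g (i : 'I_(dn R)),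
    counit (iota g * x ^+ i) = ((i : nat) == 0%N)%:R;
  HR_antipode : forall g (i : 'I_(dn R)),
    antipode (iota g * x ^+ i) = (- x * iota (da R)^-1%g) ^+ i * iota g^-1%g
}.

Definition is_HR (k : fieldType) (p : nat) (R : hopf_datum k p)
    (H : hopfAlgebra k) : Prop :=
  exists (iota : dG R -> H) (x : H), HR_spec iota x.

(* Main.v *)
Require Import Defs.
From HB Require Import structures.
From mathcomp Require Import all_boot all_order all_algebra.
From mathcomp Require Import all_fingroup all_solvable all_field.
Set Implicit Arguments.
Unset Strict Implicit.
Unset Printing Implicit Defensive.
Import GRing.Theory.
Local Open Scope ring_scope.

(**
Write e(g, i) for the basis element g x^i of H_R, where 0 <= i < n. The
coproduct of e(g, i) is computed by the q-binomial theorem without ever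
reaching x^n:
  Delta e(g, i) = sum_m [i choose m] e(g, m) (x) e(g a^m, i - m),
with [i choose m] the q-binomial coefficient at q = chi(a)^-1. Hence, if c(g, i)
denotes the coefficients of y, the coefficient of e(g, i) (x) e(h, j) in
Delta(y) is [i + j choose i] c(g, i + j) if h = g a^i, and 0 otherwise
([hcoef_comul]). As a coalgebra H_R is thus graded by the degree in x and does
not see alpha. Everything on the coalgebra side is read off this one formula.

- If Delta(y) = y (x) y, then c(g, i)^2 is a multiple of c(g, 2 i), so downward
  induction on i kills all coefficients of positive degree, and y is an element
  of G ([grouplike_iota]).
- Suppose that Delta(y) = y (x) b + 1 (x) y with b in G, y <> 0, and that
  b y = zeta y b with zeta <> 1. The formula shows that y is supported on the
  elements 1 and b of G, on which conjugation by b is trivial, and on those x^d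
  for which b = a^d. The eigenvalue kills the former, and gives
  chi(a)^(d d) = zeta <> 1 for the latter, so that chi(a)^d <> 1. Then
  [d choose 1] = 1 + q + ... + q^(d-1) is nonzero, whereas for d > 1 the
  coefficient [d choose 1] c(1, d) of x (x) a x^(d-1) in Delta(y) has to vanish.
  Only d = 1 remains: b = a, and y is a multiple of x
  ([skew_primitive_eigenvector]). In this way the skew-primitive elements
  x^(N p^i) are set aside without computing q-binomials modulo p.

A Hopf isomorphism F therefore restricts to a bijection f of the grouplike
elements. It sends x to a skew-primitive element that is an eigenvector, with
eigenvalue chi(a) <> 1, for conjugation by f(a); so f(a) = a' and
F(x) = beta x'. Conjugation of x by G gives chi = chi' o f, hence N = N';
comparison of dimensions gives n = n', hence r = r'; and F turns the relation
for x^n into a second expression of x'^n, whose coefficients on the basis are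
compared with those of the relation in H' ([iso_parameters]).

Conversely, H_R is presented as an algebra by its relations
([HR_universal]). The data (f, beta) make f and beta x' satisfy them in H',
which produces an algebra map; it rescales one monomial basis into the other, so
it is bijective, and it respects the Hopf structure because it does so on
generators ([parameters_iso]).
*)

(** * Linear forms and maps on tensor products *)

Section TensorMaps.
Variable k : fieldType.

Section Pure.
Variables U V : vectType k.

Lemma pureDl (u u' : U) (v : V) : (u + u') *t v = u *t v + u' *t v.
Proof. by have [h _] := pure_bilinear U V; have := h v 1 u u'; rewrite !scale1r. Qed.

Lemma pureDr (u : U) (v v' : V) : u *t (v + v') = u *t v + u *t v'.
Proof. by have [_ h] := pure_bilinear U V; have := h u 1 v v'; rewrite !scale1r. Qed.

Lemma pureZl c (u : U) (v : V) : (c *: u) *t v = c *: (u *t v).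
Proof. by apply/matrixP=> i j; rewrite !mxE linearZ /= mulrA. Qed.

Lemma pureZr c (u : U) (v : V) : u *t (c *: v) = c *: (u *t v).
Proof. by apply/matrixP=> i j; rewrite !mxE linearZ /= mulrCA. Qed.

Definition tens_form (phi : U -> k) (psi : V -> k) : tens U V -> k^o :=
  tens_ext (fun u v => phi u * psi v : k^o).

HB.instance Definition _ phi psi :=
  GRing.Linear.copy (tens_form phi psi) (tens_ext (fun u v => phi u * psi v : k^o)).

Lemma tens_formE (phi : {linear U -> k^o}) (psi : {linear V -> k^o}) u v :
  tens_form phi psi (u *t v) = phi u * psi v.
Proof.
rewrite /tens_form tens_extE //; split=> [y|z] c s t; rewrite linearP /=.
  by rewrite mulrDl -mulrA.
by rewrite mulrDr mulrCA.
Qed.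
End Pure.

Section Map.
Variables U V U' V' : vectType k.
Variables (F : U -> U') (K : V -> V').

HB.instance Definition _ :=
  GRing.Linear.copy (tens_map F K) (tens_ext (fun u v => F u *t K v)).
End Map.

Lemma tens_mapE (U V U' V' : vectType k) (F : {linear U -> U'})
    (K : {linear V -> V'}) u v :
  tens_map F K (u *t v) = F u *t K v.
Proof.
rewrite /tens_map tens_extE //; split=> [y|z] c s t; rewrite linearP.
  by rewrite pureDl pureZl.
by rewrite pureDr pureZr.
Qed.

Lemma tens_mapK (U U' : vectType k) (F : {linear U -> U'})
    (K : {linear U' -> U}) :
  cancel F K -> cancel (tens_map F F) (tens_map K K).
Proof.
move=> FK; apply: (tens_ind (f := tens_map K K \o tens_map F F) (g := idfun)).
by move=> u v /=; rewrite !tens_mapE !FK.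
Qed.

Section AlgebraMap.
Variables (A A' : falgType k) (F : {lrmorphism A -> A'}).

Lemma tens_map_is_multiplicative : monoid_morphism (tens_map F F).
Proof.
split=> [|s t]; first by rewrite -pure11 tens_mapE rmorph1.
apply: (tens_ind (f := tens_map F F \o (t \o* idfun))
                 (g := tens_map F F t \o* tens_map F F)) => a b /=.
apply: (tens_ind (f := tens_map F F \o ((a *t b) \*o idfun))
                 (g := tens_map F F (a *t b) \*o tens_map F F)) => c d /=.
by rewrite !(pureM, tens_mapE, rmorphM).
Qed.

HB.instance Definition _ :=
  GRing.isMonoidMorphism.Build (tens A A) (tens A' A') (tens_map F F)
    tens_map_is_multiplicative.
End AlgebraMap.
End TensorMaps.

(** * Coordinates in a basis indexed by a finite type *)

Section BasisCoef.
Variables (k : fieldType) (V : vectType k) (T : finType) (E : T -> V).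

Definition basis_coef (t : T) (y : V) : k^o :=
  coord (image_tuple E (mem T)) (enum_rank t) y.

Lemma basis_coef_is_linear t : linear (basis_coef t).
Proof. by move=> c u v; rewrite /basis_coef linearP. Qed.

HB.instance Definition _ t :=
  GRing.isLinear.Build k V k^o _ (basis_coef t) (basis_coef_is_linear t).

Hypothesis basisE : basis_of {:V} [seq E t | t : T].

Lemma basis_coef_delta t u : basis_coef t (E u) = (t == u)%:R.
Proof.
have EE : E u = (image_tuple E (mem T))`_(enum_rank u).
  by rewrite nth_image enum_rankK.
rewrite EE /basis_coef coord_free; first by rewrite eq_sym (inj_eq enum_rank_inj).
exact: basis_free basisE.
Qed.

Lemma basis_coef_sum y : y = \sum_t basis_coef t y *: E t.
Proof.
rewrite {1}(coord_basis (X := image_tuple E (mem T)) basisE (memvf y)).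
rewrite (reindex _ (onW_bij _ (@enum_rank_bij T))) /=; apply: eq_bigr => t _.
by rewrite nth_image enum_rankK.
Qed.
End BasisCoef.

(** * The q-binomial theorem *)

Section QBinomial.
Variables (k : fieldType).
Implicit Type q : k.

(** Gaussian binomials by a Pascal rule, so that q may be a root of unity, where
    the quotient of q-factorials makes no sense. *)
Fixpoint qbin q (i m : nat) : k :=
  match i, m with
  | _, 0 => 1
  | 0, _.+1 => 0
  | i'.+1, m'.+1 => q ^+ (i' - m') * qbin q i' m' + qbin q i' m'.+1
  end.

Lemma qbin0 q i : qbin q i 0 = 1. Proof. by case: i. Qed.

Lemma qbin_small q i m : (i < m)%N -> qbin q i m = 0.
Proof.
elim: i m => [|i IHi] [|m] //= lim; by rewrite !IHi ?mulr0 ?addr0 // ltnW.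
Qed.

Lemma qbinn q i : qbin q i i = 1.
Proof. by elim: i => //= i ->; rewrite subnn expr0 mul1r qbin_small ?addr0. Qed.

Lemma qbin1 q i : qbin q i 1 = \sum_(j < i) q ^+ j.
Proof.
elim: i => [|i IHi]; first by rewrite big_ord0.
by rewrite big_ord_recr /= qbin0 IHi subn0 mulr1 addrC.
Qed.
End QBinomial.

Section QBinomialTheorem.
Variables (k : fieldType) (A : algType k) (q : k) (u v : A).
Hypothesis vu : v * u = q *: (u * v).

Lemma qcomm_exp j : v ^+ j * u = q ^+ j *: (u * v ^+ j).
Proof.
elim: j => [|j IHj]; first by rewrite !expr0 mul1r mulr1 scale1r.
rewrite exprS -mulrA IHj -scalerAr (mulrA v) vu -scalerAl scalerA -exprSr.
by rewrite -mulrA -exprS.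
Qed.

Theorem qbinomial i :
  (u + v) ^+ i = \sum_(m < i.+1) qbin q i m *: (u ^+ m * v ^+ (i - m)).
Proof.
elim: i => [|i IHi].
  by rewrite big_ord1 qbin0 subnn !expr0 mulr1 scale1r.
have -> : (u + v) ^+ i.+1
    = \sum_(m < i.+1) (q ^+ (i - m) * qbin q i m)
                       *: (u ^+ m.+1 * v ^+ (i - m))
      + \sum_(m < i.+1) qbin q i m *: (u ^+ m * v ^+ (i.+1 - m)).
  rewrite exprSr IHi mulr_suml -big_split; apply: eq_bigr => m _ /=.
  rewrite mulrDr -!scalerAl -!mulrA qcomm_exp -scalerAr scalerA.
  by rewrite [qbin _ _ _ * _]mulrC (mulrA _ u) -!exprSr subSn // -ltnS.
rewrite [in RHS]big_ord_recl [X in _ + X = _]big_ord_recl /= !qbin0 !subn0 expr0.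
rewrite addrCA; congr (_ + _).
rewrite [RHS](eq_bigr (fun m : 'I_i.+1 => (q ^+ (i - m) * qbin q i m)
          *: (u ^+ m.+1 * v ^+ (i - m))
        + qbin q i m.+1 *: (u ^+ m.+1 * v ^+ (i - m)))); last first.
  by move=> m _; rewrite -scalerDl.
rewrite big_split; congr (_ + _); rewrite big_ord_recr /= qbin_small // scale0r.
by rewrite addr0.
Qed.
End QBinomialTheorem.

(** * The defining relations of H_R in an arbitrary algebra *)

Section Relations.
Variables (k : fieldType) (p : nat) (R : hopf_datum k p).

(** The algebra relations of H_R alone, with neither basis nor coproduct, for
    they have to be checked on the images of the generators under a map yet to
    be constructed. *)
Record HR_rels (A : algType k) (j : dG R -> A) (z : A) : Prop := HRRels {
  rels_1 : j 1%g = 1;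
  rels_M : forall g h, j (g * h)%g = j g * j h;
  rels_conj : forall g, j g * z * j g^-1%g = dchi g *: z;
  rels_pow : z ^+ dn R = dalpham1 R *: (j (da R ^+ dn R)%g - 1)
               + \sum_(i < dr R) dalpha i *: z ^+ (p ^ i * dN R)
}.

Section RelationsTheory.
Variables (A : algType k) (j : dG R -> A) (z : A).
Hypothesis jz : HR_rels j z.

Lemma rels_X g m : j (g ^+ m)%g = j g ^+ m.
Proof.
elim: m => [|m IHm]; first by rewrite expg0 expr0 (rels_1 jz).
by rewrite expgS exprS (rels_M jz) IHm.
Qed.

Lemma relsK g : j g * j g^-1%g = 1.
Proof. by rewrite -(rels_M jz) mulgV (rels_1 jz). Qed.

Lemma relsVK g : j g^-1%g * j g = 1.
Proof. by rewrite -(rels_M jz) mulVg (rels_1 jz). Qed.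

Lemma rels_comm g : j g * z = dchi g *: (z * j g).
Proof. by rewrite scalerAl -(rels_conj jz) -!mulrA relsVK mulr1. Qed.

Lemma rels_commX m g : z ^+ m * j g = (dchi g)^-1 ^+ m *: (j g * z ^+ m).
Proof.
apply: qcomm_exp.
by rewrite rels_comm scalerA mulVf ?scale1r // dchi_neq0.
Qed.

(** Rewriting x^(n+m) in terms of smaller exponents; this drives the induction
    on the exponent in [HR_universal]. *)
Lemma rels_expD m : z ^+ (dn R + m)
  = dalpham1 R *: (j (da R ^+ dn R)%g * z ^+ m - z ^+ m)
    + \sum_(i < dr R) dalpha i *: z ^+ (p ^ i * dN R + m).
Proof.
rewrite exprD (rels_pow jz) mulrDl mulr_suml -scalerAl mulrBl mul1r.
by congr (_ + _); apply: eq_bigr => i _; rewrite exprD scalerAl.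
Qed.

End RelationsTheory.

Hypothesis p_gt1 : (1 < p)%N.

Lemma dN_gt1 : (1 < dN R)%N.
Proof.
have := prim_order_gt0 (dN_order R); rewrite leq_eqVlt => /orP[/eqP N1|//].
by move: (dchi_a_neq1 R) (prim_expr_order (dN_order R)); rewrite -N1 expr1 => /eqP.
Qed.

Lemma dn_gt1 : (1 < dn R)%N.
Proof.
apply: leq_trans dN_gt1 _; rewrite leq_pmull // expn_gt0.
by rewrite (ltnW p_gt1).
Qed.

Lemma low_degree_lt (i : nat) : (i < dr R)%N -> (p ^ i * dN R < dn R)%N.
Proof.
by move=> ir; rewrite ltn_pmul2r ?(ltnW dN_gt1) // ltn_exp2l.
Qed.

Lemma low_degree_gt0 i : (0 < p ^ i * dN R)%N.
Proof. by rewrite muln_gt0 expn_gt0 (ltnW p_gt1) (ltnW dN_gt1). Qed.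

Lemma low_degree_inj i l : (p ^ i * dN R == p ^ l * dN R)%N = (i == l).
Proof. by rewrite eqn_pmul2r ?(ltnW dN_gt1) // eqn_exp2l. Qed.

End Relations.

(** * Coefficients of elements and of coproducts *)

Section Model.
Variables (k : fieldType) (p : nat) (R : hopf_datum k p) (H : hopfAlgebra k).
Variables (iota : dG R -> H) (x : H).
Hypothesis HR : HR_spec iota x.
Hypothesis p_gt1 : (1 < p)%N.

Local Notation n := (dn R).
Local Notation a := (da R).

Lemma HR_rels_model : HR_rels iota x.
Proof.
by case: HR.
Qed.
Let rels := HR_rels_model.

Definition monomial (t : dG R * 'I_n) := iota t.1 * x ^+ t.2.

(** The degree is a natural number rather than an ordinal, with value 0 from
    degree n on, so that the degrees of the two factors of a tensor can be
    added freely, and so that models with propositionally equal n can be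
    compared without casts. *)
Definition hcoef (g : dG R) (i : nat) (y : H) : k^o :=
  if insub i is Some i' then basis_coef monomial (g, i') y else 0.

Local Notation c := hcoef.

Lemma hcoef_is_linear g i : linear (hcoef g i).
Proof.
rewrite /hcoef => d u v; case: insub => [i'|]; last by rewrite scaler0 addr0.
by rewrite linearP.
Qed.

HB.instance Definition _ g i :=
  GRing.isLinear.Build k H k^o _ (hcoef g i) (hcoef_is_linear g i).

Lemma hcoefZ g i d y : c g i (d *: y) = d * c g i y.
Proof. by rewrite linearZ. Qed.

Lemma hcoef_ge g i y : (n <= i)%N -> c g i y = 0.
Proof. by move=> ni; rewrite /hcoef insubF // ltnNge ni. Qed.

Lemma hcoef_mon g i h j :
  (j < n)%N -> c g i (iota h * x ^+ j) = ((g == h) && (i == j))%:R.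
Proof.
move=> jn; have [ni|ni] := leqP n i.
  by rewrite hcoef_ge // gtn_eqF ?andbF // (leq_trans jn).
rewrite /hcoef (insubT (fun i => i < n)%N ni) /=.
rewrite -[iota h * _]/(monomial (h, Ordinal jn)).
rewrite basis_coef_delta //; exact: HR_basis HR.
Qed.

Lemma hcoef_iota g i h : c g i (iota h) = ((g == h) && (i == 0%N))%:R.
Proof.
rewrite -[iota h]mulr1 -[X in _ * X](expr0 x) hcoef_mon //.
exact: ltn_trans (dn_gt1 R p_gt1).
Qed.

Lemma hcoef_exp g i j : (j < n)%N -> c g i (x ^+ j) = ((g == 1%g) && (i == j))%:R.
Proof. by move=> jn; rewrite -[x ^+ j]mul1r -(HR_1 HR) hcoef_mon. Qed.

Lemma hcoef_sum y :
  y = \sum_g \sum_(i < n) c g i y *: (iota g * x ^+ i).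
Proof.
rewrite pair_bigA {1}(basis_coef_sum (HR_basis HR) y) /=.
apply: eq_bigr => -[g i] _ /=; congr (_ *: _).
rewrite /hcoef (insubT (fun i => i < n)%N (ltn_ord i)).
by congr (basis_coef _ (_, _) _); apply: val_inj.
Qed.

Lemma hcoef_inj y y' : (forall g i, c g i y = c g i y') -> y = y'.
Proof.
move=> yy'; rewrite (hcoef_sum y) (hcoef_sum y').
by apply: eq_bigr => g _; apply: eq_bigr => i _; rewrite yy'.
Qed.

Lemma HR_linear_ext (W : lmodType k) (f f' : {linear H -> W}) :
  (forall g i, (i < n)%N -> f (iota g * x ^+ i) = f' (iota g * x ^+ i)) -> f =1 f'.
Proof.
move=> ff' y; rewrite (hcoef_sum y) !linear_sum; apply: eq_bigr => g _.
by rewrite !linear_sum; apply: eq_bigr => i _; rewrite !linearZ /= ff'.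
Qed.

Lemma HR_lrmorphism_ext (A : lalgType k) (f f' : {lrmorphism H -> A}) :
  (forall g, f (iota g) = f' (iota g)) -> f x = f' x -> f =1 f'.
Proof.
move=> fg fx; apply: HR_linear_ext => g i _.
by rewrite !rmorphM !rmorphXn /= fg fx.
Qed.

Lemma x_neq0 : x != 0.
Proof.
apply: contraTneq (oner_neq0 k) => x0; have := hcoef_exp 1%g 1 (dn_gt1 R p_gt1).
by rewrite !eqxx expr1 x0 linear0 => /esym/eqP; rewrite negbK.
Qed.

Lemma iota_inj : injective iota.
Proof.
move=> g h gh; have := hcoef_iota g 0 g; rewrite gh hcoef_iota !eqxx !andbT.
by case: (g =P h) => // _ /esym/eqP; rewrite oner_eq0.
Qed.

Lemma iota_neq0 g : iota g != 0.
Proof.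
apply: contraNneq (oner_neq0 H) => g0.
by rewrite -(relsK rels g) g0 mul0r.
Qed.

Lemma comul_iota g : comul (iota g) = iota g *t iota g.
Proof.
have := HR_comul HR g (Ordinal (ltnW (dn_gt1 R p_gt1))) => /=.
by rewrite !expr0 !mulr1.
Qed.

Lemma comul_x : comul x = x *t iota a + 1 *t x.
Proof.
have := HR_comul HR 1%g (Ordinal (dn_gt1 R p_gt1)) => /=.
by rewrite !expr1 (HR_1 HR) pure11 !mul1r.
Qed.

Lemma counit_iota g : counit (iota g) = 1.
Proof.
have := HR_counit HR g (Ordinal (ltnW (dn_gt1 R p_gt1))) => /=.
by rewrite expr0 mulr1.
Qed.

Lemma counit_x : counit x = 0.
Proof.
have := HR_counit HR 1%g (Ordinal (dn_gt1 R p_gt1)) => /=.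
by rewrite expr1 (HR_1 HR) mul1r.
Qed.

Local Notation qb := (qbin (dchi a)^-1).

Lemma pureX (u v : H) m : (u *t v) ^+ m = u ^+ m *t v ^+ m.
Proof.
by elim: m => [|m IHm]; rewrite ?expr0 ?pure11 // !exprS IHm pureM.
Qed.

Lemma comul_mon g i : comul (iota g * x ^+ i)
  = \sum_(m < i.+1) qb i m *:
      ((iota g * x ^+ m) *t (iota (g * a ^+ m)%g * x ^+ (i - m))).
Proof.
rewrite rmorphM rmorphXn /= comul_iota comul_x (@qbinomial _ _ (dchi a)^-1); last first.
  rewrite !pureM mul1r mulr1 -pureZr; congr (_ *t _).
  by have := rels_commX rels 1 a; rewrite !expr1.
rewrite mulr_sumr; apply: eq_bigr => m _; rewrite -scalerAr; congr (_ *: _).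
by rewrite !pureX !pureM expr1n !mulr1 (HR_M HR) (rels_X rels) mulrA.
Qed.

(** The coproduct is graded by the degree in x, and the coefficient of a given
    pure tensor involves a single coefficient of y. By linearity it suffices to
    look at a basis element, where at most one term of the q-binomial expansion
    contributes. *)
Lemma hcoef_comul g i h j y :
  tens_form (c g i) (c h j) (comul y)
    = (h == (g * a ^+ i)%g)%:R * qb (i + j) i * c g (i + j) y.
Proof.
pose f y : k^o := (h == (g * a ^+ i)%g)%:R * qb (i + j) i * c g (i + j) y.
have flin : linear f by move=> d u v; rewrite /f linearP /= mulrDr mulrCA.
pose F : {linear H -> k^o} := HB.pack f (GRing.isLinear.Build k H k^o _ f flin).
apply: (HR_linear_ext (f := tens_form (c g i) (c h j) \o comul) (f' := F)) => u d dn.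
rewrite /= /f comul_mon linear_sum /= hcoef_mon //.
rewrite (eq_bigr (fun m : 'I_d.+1 => if (m == i :> nat) then
   qb d i * ((g == u) && (h == (u * a ^+ i)%g) && (j == d - i)%N)%:R else 0)); last first.
  move=> m _; rewrite linearZ /= tens_formE /= !hcoef_mon; last 2 first.
  - by rewrite (leq_ltn_trans _ dn) // leq_subr.
  - by rewrite (leq_ltn_trans _ dn) // -ltnS.
  have [->|/eqP/negbTE mi] := (m : nat) =P i; last first.
    by rewrite [i == m]eq_sym mi andbF mul0r scaler0.
  by rewrite eqxx andbT -natrM mulnb andbA.
rewrite -big_mkcond /=.
have [di|di] := leqP i d.
  rewrite (big_pred1 (inord i)); last first.
    by move=> m /=; apply/eqP/eqP => [<-|->]; rewrite ?inord_val ?inordK.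
  rewrite -(eqn_add2l i j) subnKC //.
  have [<-|_] := g =P u; last by rewrite !mulr0.
  have [<-|_] := (i + j)%N =P d; last by rewrite !andbF !mulr0.
  by rewrite !andbT mulr1 mulrC.
rewrite big_pred0 => [|m]; last by rewrite ltn_eqF // (leq_ltn_trans _ di) // -ltnS.
by rewrite gtn_eqF ?andbF ?mulr0 // (leq_trans di) // leq_addr.
Qed.

(** * Grouplike and skew-primitive elements *)

(** If y is grouplike, the coefficient of e(g, i) (x) e(g, i) in its coproduct is
    the square of c(g, i), but it is also a multiple of c(g, 2 i), which lies
    further up in the grading. Hence only degree 0 survives; there the
    coefficients are orthogonal idempotents of a field. *)
Lemma grouplike_iota y : comul y = y *t y -> y != 0 -> exists g, y = iota g.
Proof.
move=> yy y0.
have key g i h j : c g i y * c h j y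
    = (h == (g * a ^+ i)%g)%:R * qb (i + j) i * c g (i + j) y.
  by rewrite -hcoef_comul yy tens_formE.
have high m g i : (0 < i)%N -> (n <= i + m)%N -> c g i y = 0.
  elim: m i => [|m IHm] i i0; first by rewrite addn0; apply: hcoef_ge.
  rewrite addnS => nim; apply/eqP; rewrite -(orbb (_ == 0)) -mulf_eq0 key.
  rewrite (IHm (i + i)%N) ?mulr0 ?addn_gt0 ?i0 //.
  by rewrite (leq_trans nim) // -addSn leq_add2r -addn1 leq_add2l.
have high0 g i : (0 < i)%N -> c g i y = 0.
  by move=> i0; apply: (high n) => //; apply: leq_addl.
have low g h : c g 0 y * c h 0 y = (h == g)%:R * c g 0 y.
  by rewrite key expg0 mulg1 qbin0 mulr1.
have [g cg] : exists g, c g 0 y != 0.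
  apply/existsP; apply: contraNT y0 => /existsPn z; apply/eqP/hcoef_inj => g i.
  rewrite linear0; case: i => [|i]; last exact: high0.
  by apply/eqP; move: (z g); rewrite negbK.
exists g; apply: hcoef_inj => h [|i]; last by rewrite high0 // hcoef_iota andbF.
rewrite hcoef_iota andbT; apply: (mulfI cg).
by rewrite low mulrC.
Qed.

(** Prescribing an eigenvalue other than 1 under conjugation by b is what
    singles out x among the skew-primitive elements: the other ones are
    combinations of 1 - b and of the x^(N p^i) with a^(N p^i) = b, all of which
    commute with b. *)
Lemma skew_primitive_eigenvector b y (zeta : k) :
    comul y = y *t iota b + 1 *t y -> iota b * y = zeta *: (y * iota b) ->
    zeta != 1 -> y != 0 ->
  b = a /\ exists2 beta, beta != 0 & y = beta *: x.
Proof.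
move=> yskew yeigen zeta1 y0.
have key g i h j : (h == (g * a ^+ i)%g)%:R * qb (i + j) i * c g (i + j) y
    = c g i y * ((h == b) && (j == 0%N))%:R + ((g == 1%g) && (i == 0%N))%:R * c h j y.
  rewrite -hcoef_comul yskew linearD /= !tens_formE /= hcoef_iota.
  by rewrite -[X in _ + c g i X * _](HR_1 HR) hcoef_iota.
(* Multiplication by b on either side permutes the basis up to scalars. *)
have shiftl g i w : c (b * g)%g i (iota b * w) = c g i w.
  pose f w : k^o := c (b * g)%g i (iota b * w).
  have flin : linear f by move=> d u v; rewrite /f mulrDr -scalerAr linearP.
  pose F : {linear H -> k^o} := HB.pack f (GRing.isLinear.Build k H k^o _ f flin).
  apply: (HR_linear_ext (f := F) (f' := c g i)) => h j jn /=.
  by rewrite /f mulrA -(HR_M HR) !hcoef_mon // (inj_eq (mulgI b)).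
have shiftr g i w : c (g * b)%g i (w * iota b) = (dchi b)^-1 ^+ i * c g i w.
  pose f w : k^o := c (g * b)%g i (w * iota b).
  have flin : linear f by move=> d u v; rewrite /f mulrDl -scalerAl linearP.
  pose F : {linear H -> k^o} := HB.pack f (GRing.isLinear.Build k H k^o _ f flin).
  pose f' w : k^o := (dchi b)^-1 ^+ i * c g i w.
  have flin' : linear f' by move=> d u v; rewrite /f' linearP /= mulrDr mulrCA.
  pose F' : {linear H -> k^o} := HB.pack f' (GRing.isLinear.Build k H k^o _ f' flin').
  apply: (HR_linear_ext (f := F) (f' := F')) => h j jn /=.
  rewrite /f /f' -mulrA (rels_commX rels) -scalerAr mulrA -(HR_M HR) hcoefZ.
  rewrite !hcoef_mon // (inj_eq (mulIg b)).
  by have [->|_] := i =P j; rewrite // !andbF !mulr0.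
have eigen g i : (b * g = g * b)%g -> c g i y = zeta * (dchi b)^-1 ^+ i * c g i y.
  by move=> bg; rewrite -[LHS]shiftl yeigen hcoefZ bg shiftr mulrA.
(* Degree 0 is supported on 1 and b, which commute with b. *)
have deg0 g : c g 0 y = 0.
  have comm0 : (b * g = g * b)%g -> c g 0 y = 0.
    move/(eigen g 0%N); rewrite expr0 mulr1 => /eqP.
    rewrite -{1}[c g 0 y]mul1r -subr_eq0 -mulrBl mulf_eq0 subr_eq0 eq_sym.
    by rewrite (negbTE zeta1) => /eqP.
  have [g1|/eqP/negbTE g1] := g =P 1%g; first by apply: comm0; rewrite g1 mulg1 mul1g.
  have [gb|/eqP/negbTE gb] := g =P b; first by rewrite comm0 // gb.
  have := key g 0%N g 0%N.
  by rewrite expg0 mulg1 eqxx qbin0 gb g1 !mul1r mulr0 mul0r addr0.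
have degg g i : g != 1%g -> c g i.+1 y = 0.
  move=> /negbTE g1; have := key g 0%N g i.+1.
  by rewrite expg0 mulg1 eqxx qbin0 andbF g1 !mul1r mulr0 mul0r addr0.
have degb i : c 1%g i.+1 y != 0 -> b = (a ^+ i.+1)%g.
  move=> ci; have := key 1%g i.+1 (a ^+ i.+1)%g 0%N.
  rewrite mul1g eqxx addn0 qbinn !mul1r andbT andbF mul0r addr0.
  have [-> //|_] := (a ^+ i.+1)%g =P b.
  by move/eqP; rewrite mulr0 (negbTE ci).
have chiX g m : dchi (g ^+ m)%g = dchi g ^+ m.
  elim: m => [|m IHm]; last by rewrite expgS exprS dchiM IHm.
  by apply: (mulfI (dchi_neq0 g)); rewrite -dchiM mulg1 mulr1.
(* In degree d >= 2, b = a^d turns the eigenvalue into chi(a)^(d d); since it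
   is not 1, neither is chi(a)^d, so the coefficient [d choose 1] of
   x (x) a x^(d-1) is a nonzero geometric sum. *)
have deg2 i : c 1%g i.+2 y = 0.
  apply/eqP; apply/negPn/negP => ci.
  have ba := degb _ ci.
  have zeta_b : dchi b ^+ i.+2 = zeta.
    have /esym := eigen 1%g i.+2 (etrans (mulg1 b) (esym (mul1g b))).
    rewrite -{2}[c _ _ y]mul1r => /(mulIf ci); rewrite exprVn => /divr1_eq.
    by move=> ->.
  have := key 1%g 1%N a i.+1.
  rewrite mul1g expg1 eqxx mul1r !andbF mulr0 mul0r addr0 add1n => /eqP.
  rewrite mulf_eq0 (negbTE ci) orbF => /eqP qb0.
  have := subrX1 (dchi a)^-1 i.+2; rewrite -qbin1 qb0 mulr0 => /eqP.
  rewrite subr_eq0 exprVn invr_eq1 => /eqP a1.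
  by move: zeta1; rewrite -zeta_b ba chiX a1 expr1n eqxx.
have yx : y = c 1%g 1%N y *: x.
  apply: hcoef_inj => g i; rewrite hcoefZ -[X in _ * c g i X]expr1 hcoef_exp ?dn_gt1 //.
  case: i => [|[|i]].
  - by rewrite deg0 andbF [RHS]mulr0.
  - rewrite andbT; have [->|/eqP g1] := g =P 1%g; first by rewrite [RHS]mulr1.
    by rewrite degg // [RHS]mulr0.
  rewrite andbF [RHS]mulr0; have [->|/eqP g1] := g =P 1%g; first exact: deg2.
  by rewrite degg.
have c1 : c 1%g 1%N y != 0 by apply: contraNneq y0 => c0; rewrite yx c0 scale0r.
by split; [rewrite (degb _ c1) expg1 | exists (c 1%g 1%N y)].
Qed.

(** * Universal property of H_R *)

(** The right-hand side of the relation for x^n determines its parameters,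
    because the exponents N p^i are positive, distinct and less than n. The
    parameter A is lost exactly when u = 1. The number r of terms is kept
    independent of R, so that the relation transported from another model can be
    read in the same way. *)
Lemma hcoef_relation (r : nat) (A : k) u (B : 'I_r -> k) : (r <= dr R)%N ->
  let w := A *: (iota u - 1) + \sum_(i < r) B i *: x ^+ (p ^ i * dN R) in
  (forall i : 'I_r, c 1%g (p ^ i * dN R) w = B i)
  /\ (u != 1%g -> c u 0 w = A).
Proof.
move=> rR w.
have cw g i : c g i w = A * (((g == u) && (i == 0%N))%:R - ((g == 1%g) && (i == 0%N))%:R)
   + \sum_(l < r) B l * ((g == 1%g) && (i == p ^ l * dN R)%N)%:R.
  rewrite /w linearD /= hcoefZ linearB linear_sum /= hcoef_iota.
  rewrite -[X in _ - c g i X](HR_1 HR) hcoef_iota; congr (_ + _).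
  apply: eq_bigr => l _; rewrite hcoefZ hcoef_exp //.
  by apply: low_degree_lt => //; apply: leq_trans rR.
split=> [i|u1]; rewrite cw.
  rewrite gtn_eqF ?low_degree_gt0 // !andbF subrr mulr0 add0r (bigD1 i) //=.
  rewrite !eqxx mulr1 big1 ?addr0 // => l li.
  by rewrite low_degree_inj // eq_sym (negbTE (li : l != i :> nat)) mulr0.
rewrite !eqxx (negbTE u1) subr0 mulr1 big1 ?addr0 // => l _.
by rewrite mulr0.
Qed.

(** The map is defined linearly on the basis. Its value on g x^i for i >= n is
    obtained by strong induction, as the relation for x^n rewrites both sides in
    the same way; multiplicativity then follows by commuting powers of x past
    elements of G. *)
Lemma HR_universal (A : algType k) (j : dG R -> A) (z : A) :
  HR_rels j z ->
  exists F : {lrmorphism H -> A}, (forall g, F (iota g) = j g) /\ F x = z.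
Proof.
move=> jz.
pose F y : A := \sum_g \sum_(i < n) c g i y *: (j g * z ^+ i).
have Flin : linear F.
  move=> d u v; rewrite /F scaler_sumr -big_split; apply: eq_bigr => g _ /=.
  rewrite scaler_sumr -big_split; apply: eq_bigr => i _ /=.
  by rewrite linearP /= scalerDl scalerA.
pose FL : {linear H -> A} := HB.pack F (GRing.isLinear.Build k H A _ F Flin).
have FD u v : F (u + v) = F u + F v by exact: (linearD FL).
have FB u v : F (u - v) = F u - F v by exact: (linearB FL).
have FZ d u : F (d *: u) = d *: F u by exact: (linearZZ FL).
have Fsum (f : 'I_(dr R) -> H) : F (\sum_l f l) = \sum_l F (f l).
  exact: (linear_sum FL).
have Flow g i : (i < n)%N -> F (iota g * x ^+ i) = j g * z ^+ i.
  move=> i_n; rewrite /F (bigD1 g) //= (bigD1 (Ordinal i_n)) //= hcoef_mon //.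
  rewrite !eqxx scale1r big1 => [|l li]; last first.
    by rewrite hcoef_mon // (negbTE (li : l != i :> nat)) andbF scale0r.
  rewrite addr0 big1 ?addr0 // => h hg; apply: big1 => l _.
  by rewrite hcoef_mon // (negbTE hg) scale0r.
have FE i : forall g, F (iota g * x ^+ i) = j g * z ^+ i.
  elim/ltn_ind: i => i IH g; have [ni|/Flow //] := leqP n i.
  have n0 := ltnW (dn_gt1 R p_gt1).
  rewrite -(subnKC ni) (rels_expD jz) (rels_expD rels).
  rewrite !mulrDr -!scalerAr !mulrBr !mulr_sumr !mulrA -(rels_M jz) -(HR_M HR).
  rewrite FD FZ FB Fsum.
  rewrite !IH ?ltn_subrL ?n0 ?(leq_trans n0) //; congr (_ + _).
  apply: eq_bigr => l _; rewrite -!scalerAr FZ IH //.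
  by rewrite -{2}(subnKC ni) ltn_add2r low_degree_lt.
have F1 : F 1 = 1.
  by rewrite -(HR_1 HR) -[iota _]mulr1 -(expr0 x) FE (rels_1 jz) mulr1.
have FM : monoid_morphism F.
  split=> // u v.
  apply: (HR_linear_ext (f := FL \o (v \o* idfun)) (f' := F v \o* FL)) => g i _ /=.
  apply: (HR_linear_ext (f := FL \o ((iota g * x ^+ i) \*o idfun))
                        (f' := F (iota g * x ^+ i) \*o FL)) => h l _ /=.
  rewrite !FE -!mulrA (mulrA (x ^+ i)) (mulrA (z ^+ i)).
  rewrite (rels_commX rels) (rels_commX jz) -!scalerAl -!scalerAr.
  rewrite FZ -!mulrA -!exprD.
  by rewrite !mulrA -(HR_M HR) FE (rels_M jz).
pose FR : {lrmorphism H -> A} := HB.pack F (GRing.isLinear.Build k H A _ F Flin)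
   (GRing.isMonoidMorphism.Build H A F FM).
exists FR; split=> [g|]; rewrite -[FR _]/(F _).
  by rewrite -[iota g]mulr1 -(expr0 x) FE expr0 mulr1.
by rewrite -[x]mul1r -(HR_1 HR) -(expr1 x) FE (rels_1 jz) mul1r expr1.
Qed.

Lemma HR_dim : \dim {:H} = (#|dG R| * n)%N.
Proof.
rewrite (size_basis (X := image_tuple (monomial) (mem _)) (HR_basis HR)).
by rewrite card_prod card_ord.
Qed.
End Model.

(** * Comparison of two models *)

Section Comparison.
Variables (k : fieldType) (p : nat) (p_gt1 : (1 < p)%N).
Variables (R R' : hopf_datum k p) (H H' : hopfAlgebra k).
Variables (iota : dG R -> H) (x : H) (iota' : dG R' -> H') (x' : H').
Hypotheses (HR : HR_spec iota x) (HR' : HR_spec iota' x').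

Local Notation c := (hcoef (R := R) iota x).
Local Notation c' := (hcoef (R := R') iota' x').

Lemma dN_eq : dchi (da R) = dchi (da R') -> dN R = dN R'.
Proof.
move=> chi_a; have ord := dN_order R; have ord' := dN_order R'.
rewrite chi_a in ord; apply/eqP; rewrite eqn_dvd.
by rewrite (prim_order_dvd ord) (prim_expr_order ord') (prim_order_dvd ord')
           (prim_expr_order ord) !eqxx.
Qed.

Section FromIsomorphism.
Variables (F : {lrmorphism H -> H'}).
Hypothesis F_bij : bijective F.
Hypothesis F_comul : forall h, comul (F h) = tens_map F F (comul h).

(** Surjectivity of f comes from the inverse K of F: it also preserves grouplike
    elements, because the injective map F (x) F sends the coproduct of K(g') to
    g' (x) g'. *)
Lemma iso_grouplikes : exists2 f : {morphism [set: dG R] >-> dG R'},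
  isom [set: dG R] [set: dG R'] f & forall g, F (iota g) = iota' (f g).
Proof.
have [K FK KF] := F_bij.
have grp g : exists g', F (iota g) == iota' g'.
  have [||g' ->] := grouplike_iota HR' p_gt1 (y := F (iota g)); last by exists g'.
    by rewrite F_comul (comul_iota HR p_gt1) tens_mapE.
  by rewrite -(rmorph0 F) (bij_eq F_bij) (iota_neq0 HR).
pose f g := xchoose (grp g).
have fE g : F (iota g) = iota' (f g) by apply/eqP/(xchooseP (grp g)).
have fM : {in [set: dG R] &, {morph f : g h / (g * h)%g}}.
  move=> g h _ _; apply: (iota_inj HR' p_gt1).
  by rewrite -fE (HR_M HR) (HR_M HR') rmorphM -!fE.
exists (Morphism fM) => //; apply/isomP; split.
  apply/injmP => g h _ _ /= gh; apply: (iota_inj HR p_gt1).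
  by apply: (bij_inj F_bij); rewrite [LHS](fE g) [RHS](fE h) gh.
apply/eqP; rewrite eqEsubset subsetT; apply/subsetP => g' _.
pose KL : {linear H' -> H} :=
  HB.pack K (GRing.isLinear.Build k H' H _ K (can2_linear FK KF)).
have [||g Kg] := grouplike_iota HR p_gt1 (y := K (iota' g')).
- apply: (can_inj (tens_mapK (K := KL) FK)).
  by rewrite -F_comul tens_mapE /= !KF (comul_iota HR' p_gt1).
- by rewrite -(bij_eq F_bij) KF rmorph0 (iota_neq0 HR').
apply/morphimP; exists g; rewrite ?inE //.
by apply: (iota_inj HR' p_gt1); rewrite /= -fE -Kg KF.
Qed.

(** As N is recovered from chi(a) and the order of G from the grouplike
    elements, the dimension determines n, and thereby r. *)
Lemma iso_dim : (#|dG R| * dn R = #|dG R'| * dn R')%N.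
Proof.
have [K FK KF] := F_bij.
rewrite -(HR_dim HR) -(HR_dim HR').
have := limg_dim_eq (f := linfun F) (U := fullv).
have -> : lker (linfun F) = 0%VS.
  by apply/eqP/lker0P => u v; rewrite !lfunE; apply: bij_inj.
rewrite capv0 => /(_ erefl) <-; congr (\dim _); apply/eqP.
rewrite eqEsubv subvf; apply/subvP => y _.
by rewrite -(KF y) -[F _]lfunE memv_img // memvf.
Qed.

Lemma iso_generator b : F (iota (da R)) = iota' b ->
  b = da R' /\ exists2 beta, beta != 0 & F x = beta *: x'.
Proof.
move=> Fa; apply: (skew_primitive_eigenvector HR' p_gt1 (zeta := dchi (da R))).
- by rewrite F_comul (comul_x HR p_gt1) linearD /= !tens_mapE /= rmorph1 Fa.
- by rewrite -Fa -!rmorphM /= (rels_comm (HR_rels_model HR)) linearZ.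
- exact: dchi_a_neq1.
- by rewrite -(rmorph0 F) (bij_eq F_bij) (x_neq0 HR p_gt1).
Qed.

End FromIsomorphism.

Theorem iso_parameters : hopf_isomorphic H H' ->
  exists er : dr R = dr R',
  exists f : {morphism [set: dG R] >-> dG R'},
  exists beta : k,
  [/\ isom [set: dG R] [set: dG R'] f,
      f (da R) = da R',
      forall g, dchi g = dchi (f g),
      beta != 0
    & (forall i : 'I_(dr R),
         beta ^+ (dN R * p ^ i) * dalpha i
           = beta ^+ dn R * dalpha (cast_ord er i))
      /\ dalpham1 R = beta ^+ dn R * dalpham1 R'].
Proof.
case=> F [F_bij F_comul _ _].
have [f f_isom fE] := iso_grouplikes F_bij F_comul.
have [fa [beta beta0 Fx]] := iso_generator F_bij F_comul (fE (da R)).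
have fchi g : dchi g = dchi (f g).
  have := congr1 F (rels_comm (HR_rels_model HR) g).
  rewrite linearZ /= !rmorphM /= fE Fx -scalerAl -scalerAr.
  rewrite (rels_comm (HR_rels_model HR')) !scalerA mulrC => /eqP.
  rewrite -subr_eq0 -scalerBl scaler_eq0.
  have /negbTE-> : x' * iota' (f g) != 0.
    apply: contraNneq (x_neq0 HR' p_gt1) => z.
    by rewrite -[x']mulr1 -(relsK (HR_rels_model HR') (f g)) mulrA z mul0r.
  by rewrite orbF subr_eq0 eq_sym => /eqP/(mulIf beta0).
have eN : dN R = dN R' by apply: dN_eq; rewrite fchi fa.
have [finj fim] := isomP f_isom.
have eG : #|dG R| = #|dG R'|.
  by rewrite -!cardsT -fim card_injm.
have en : dn R = dn R'.
  have G0 : (0 < #|dG R'|)%N by rewrite -cardsT cardG_gt0.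
  by have /eqP := iso_dim F_bij; rewrite eG (eqn_pmul2l G0) => /eqP.
have er : dr R = dr R'.
  move/eqP: en; rewrite /dn eN eqn_pmul2r ?(ltnW (dN_gt1 R')) //.
  by rewrite eqn_exp2l // => /eqP.
have FfX m : f (da R ^+ m)%g = (da R' ^+ m)%g by rewrite morphX ?inE // fa.
(* The relation for x^n, transported by F and divided by beta^n. *)
have rel1 : x' ^+ dn R'
    = (beta ^- dn R * dalpham1 R) *: (iota' (da R' ^+ dn R')%g - 1)
      + \sum_(i < dr R) (beta ^- dn R * (beta ^+ (dN R * p ^ i) * dalpha i))
                          *: x' ^+ (p ^ i * dN R').
  have := congr1 F (HR_pow HR).
  rewrite rmorphXn /= Fx exprZn linearD linearZ linearB linear_sum /= fE rmorph1.
  rewrite FfX en => /(congr1 ( *:%R (beta ^- dn R'))).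
  rewrite scalerA mulVf ?expf_neq0 // scale1r => ->.
  rewrite scalerDr scalerA scaler_sumr; congr (_ + _); apply: eq_bigr => i _.
  rewrite linearZ rmorphXn /= Fx exprZn !scalerA eN.
  by rewrite [in RHS](mulnC (dN R')) -!mulrA; congr (_ * _ *: _); rewrite mulrC.
have [hi hm] := hcoef_relation HR' p_gt1 (beta ^- dn R * dalpham1 R)
   (da R' ^+ dn R')%g
   (fun i => beta ^- dn R * (beta ^+ (dN R * p ^ i) * dalpha i)) (eq_leq er).
have [hi' hm'] := hcoef_relation HR' p_gt1 (dalpham1 R') (da R' ^+ dn R')%g
   (@dalpha k p R') (leqnn _).
rewrite -rel1 in hi hm; rewrite -(HR_pow HR') in hi' hm'.
exists er, f, beta; split=> //; split=> [i|].
  have := hi' (cast_ord er i); rewrite /= hi => <-.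
  by rewrite mulVKf // expf_neq0.
(* When a'^n = 1 the coefficients say nothing about the parameter of index -1,
   but then it is required to be 0 on both sides. *)
have [a1|/eqP a1] := (da R' ^+ dn R')%g =P 1%g; last first.
  by rewrite -(hm' a1) (hm a1) mulVKf // expf_neq0.
rewrite (dalpham1_0 a1) mulr0; apply: dalpham1_0.
by apply/eqP; rewrite -(morph_injm_eq1 finj) ?inE // FfX en a1.
Qed.

Theorem parameters_iso (er : dr R = dr R')
    (f : {morphism [set: dG R] >-> dG R'}) (beta : k) :
    isom [set: dG R] [set: dG R'] f -> f (da R) = da R' ->
    (forall g, dchi g = dchi (f g)) -> beta != 0 ->
    (forall i : 'I_(dr R), beta ^+ (dN R * p ^ i) * dalpha i
       = beta ^+ dn R * dalpha (cast_ord er i)) ->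
    dalpham1 R = beta ^+ dn R * dalpham1 R' ->
  hopf_isomorphic H H'.
Proof.
move=> f_isom fa fchi beta0 hi hm.
have [finj fim] := isomP f_isom.
have fM g h : f (g * h)%g = (f g * f h)%g by rewrite morphM ?inE.
have fV g : f g^-1%g = (f g)^-1%g by rewrite morphV ?inE.
have f_inj : injective f by move=> g h; apply: (injmP finj); rewrite inE.
have eN : dN R = dN R' by apply: dN_eq; rewrite fchi fa.
have en : dn R = dn R' by rewrite /dn er eN.
have fX m : f (da R ^+ m)%g = (da R' ^+ m)%g by rewrite morphX ?inE // fa.
have rels : HR_rels (R := R) (iota' \o f) (beta *: x').
  split=> [|g h|g|] /=.
  - by rewrite morph1 (HR_1 HR').
  - by rewrite fM (HR_M HR').
  - by rewrite fV -scalerAr -scalerAl (HR_conj HR') fchi !scalerA mulrC.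
  rewrite exprZn {2}en (HR_pow HR') scalerDr scalerA -hm fX en; congr (_ + _).
  rewrite scaler_sumr (reindex (cast_ord er)) /=; last first.
    by apply: onW_bij; exists (cast_ord (esym er)); [apply: cast_ordK | apply: cast_ordKV].
  apply: eq_bigr => i _; rewrite exprZn !scalerA -en -hi eN.
  by rewrite mulrC (mulnC (dN R')).
have [F [Fi Fx]] := HR_universal HR p_gt1 rels.
have Fmon g i : F (iota g * x ^+ i) = beta ^+ i *: (iota' (f g) * x' ^+ i).
  by rewrite rmorphM rmorphXn /= Fi Fx exprZn -scalerAr.
(* Coefficients are multiplied by powers of beta and reindexed by f. *)
have F_inj : injective F.
  have coefF g i y : c' (f g) i (F y) = beta ^+ i * c g i y.
    pose u y : k^o := beta ^+ i * c g i y.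
    have ulin : linear u by move=> d v w; rewrite /u linearP /= mulrDr mulrCA.
    pose U : {linear H -> k^o} := HB.pack u (GRing.isLinear.Build k H k^o _ u ulin).
    apply: (HR_linear_ext HR (f := c' (f g) i \o F) (f' := U)) => h l ln /=.
    rewrite /u Fmon hcoefZ (hcoef_mon HR') -?en // (hcoef_mon HR) //.
    rewrite (inj_eq f_inj).
    by have [->|_] := i =P l; rewrite // !andbF !mulr0.
  move=> y y' Fyy; apply: (hcoef_inj HR) => g i.
  by apply: (mulfI (expf_neq0 i beta0)); rewrite -!coefF Fyy.
have F_onto y' : exists y, F y == y'.
  have pre g' : exists g, f g == g'.
    have : g' \in (f @* [set: dG R])%g by rewrite fim inE.
    by case/morphimP => g _ _ ->; exists g.
  exists (\sum_g' \sum_(i < dn R') (beta ^- i * c' g' i y') *: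
            (iota (xchoose (pre g')) * x ^+ i)).
  rewrite linear_sum {2}(hcoef_sum HR' y'); apply/eqP; apply: eq_bigr => g' _.
  rewrite linear_sum; apply: eq_bigr => i _; rewrite linearZ /= Fmon scalerA.
  rewrite (eqP (xchooseP (pre g'))) mulrC mulrA mulfV ?mul1r //.
  by rewrite expf_neq0.
exists F; split.
- exists (fun y' => xchoose (F_onto y')) => [y|y'].
    by apply: F_inj; apply/eqP/(xchooseP (F_onto _)).
  exact/eqP/(xchooseP (F_onto _)).
- apply: (HR_lrmorphism_ext HR (f := comul \o F) (f' := tens_map F F \o comul)) => [g|] /=.
    by rewrite Fi /= (comul_iota HR p_gt1) (comul_iota HR' p_gt1) tens_mapE /= Fi.
  rewrite Fx linearZ /= (comul_x HR p_gt1) (comul_x HR' p_gt1) [RHS]linearD /=.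
  by rewrite !tens_mapE /= rmorph1 Fi Fx /= fa scalerDr pureZl pureZr.
- apply: (HR_lrmorphism_ext HR (f := counit \o F) (f' := counit)) => [g|] /=.
    by rewrite Fi (counit_iota HR p_gt1) (counit_iota HR' p_gt1).
  by rewrite Fx linearZ /= (counit_x HR p_gt1) (counit_x HR' p_gt1) scaler0.
apply: (HR_linear_ext HR (f := antipode \o F) (f' := F \o antipode)) => g i i_n /=.
have i_n' : (i < dn R')%N by rewrite -en.
rewrite Fmon linearZ /=.
rewrite -[i]/(Ordinal i_n : nat) (HR_antipode HR) /=.
rewrite -[i]/(Ordinal i_n' : nat) (HR_antipode HR') /=.
rewrite rmorphM rmorphXn rmorphM rmorphN /= !Fi Fx /= !fV fa.
by rewrite !mulNr -scalerAl -scalerN exprZn scalerAl.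
Qed.

End Comparison.

Theorem lemma3p6 (k : fieldType) (p : nat) (hp : p \in [pchar k])
    (R R' : hopf_datum k p) (H H' : hopfAlgebra k)
    (HR : is_HR R H) (HR' : is_HR R' H') :
  hopf_isomorphic H H' <->
  exists er : dr R = dr R',
  exists f : {morphism [set: dG R] >-> dG R'},
  exists beta : k,
  [/\ isom [set: dG R] [set: dG R'] f,
      f (da R) = da R',
      forall g, dchi g = dchi (f g),
      beta != 0
    & (forall i : 'I_(dr R),
         beta ^+ (dN R * p ^ i) * dalpha i
           = beta ^+ dn R * dalpha (cast_ord er i))
      /\ dalpham1 R = beta ^+ dn R * dalpham1 R'].
Proof.
have p_gt1 := prime_gt1 (pcharf_prime hp).
case: HR => iota [x HR]; case: HR' => iota' [x' HR'].
split; first exact: (iso_parameters p_gt1 HR HR').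
case=> er [f [beta [f_isom fa fchi beta0 [hi hm]]]].
exact: (parameters_iso p_gt1 HR HR' f_isom fa fchi beta0 hi hm).
Qed.
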